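(* Let $d\ge 1$ be an integer and let $A,B\subset\mathbb{R}^d$ be finite sets with $|A|=m$. Assume that $B$ is proper $d$-dimensional and that $A\subset\operatorname{conv} B$. Then $$|A+B|\ge m(d+1)-\frac{d(d+1)}{2}.$$
   Context: A set in $\mathbb{R}^d$ is proper $d$-dimensional if it is not contained in any affine hyperplane. $\operatorname{conv} B$ denotes the convex hull of $B$. The sumset is $X+Y=\{x+y: x\in X,\ y\in Y\}$, and $|X|$ denotes cardinality. *)

(* Defs.v *)
From mathcomp Require Import all_boot all_order all_algebra finmap.
From mathcomp Require Import boolp classical_sets reals convex.

Set Implicit Arguments.
Unset Strict Implicit.
Unset Printing Implicit Defensive.

Import Order.TTheory GRing.Theory Num.Theory.

Local Open Scope classical_set_scope.
Local Open Scope ring_scope.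

Definition convex_hull (R : realType) (d : nat) (S : set 'rV[R]_d) :
    set 'rV[R]_d :=
  smallest (@convex_set R 'rV[R]_d) S.

Definition affine_hyperplane (R : realType) (d : nat) (H : set 'rV[R]_d) : Prop :=
  exists (u : 'rV[R]_d) (c : R),
    u != 0 /\ H = [set x | \sum_(i < d) u 0 i * x 0 i = c].

Definition proper_dimensional (R : realType) (d : nat) (S : set 'rV[R]_d) : Prop :=
  forall H : set 'rV[R]_d, affine_hyperplane H -> ~ (S `<=` H).

Definition sumset (R : realType) (d : nat) (X Y : {fset 'rV[R]_d}) :
    {fset 'rV[R]_d} :=
  [fset (x + y)%R | x in X, y in Y]%fset.

(* Main.v *)
Require Import Defs.
From mathcomp Require Import all_boot all_order all_algebra finmap.
From mathcomp Require Import boolp classical_sets interval_inference reals convex.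
From mathcomp Require Import lra zify.

Import Order.TTheory GRing.Theory Num.Theory.

Local Open Scope classical_set_scope.
Local Open Scope ring_scope.

(** Order [B] as [b_0, b_1, ...] so that its first [d+1] points are affinely
independent, and represent points of [conv B] by convex combinations that are
minimal for the lexicographic order in which later coordinates weigh more (this
is the triangulation of [conv B] obtained by adding the points one at a time).
Each [a] in [A] lies in a simplex [T(a)] all of whose convex combinations are
minimal. If [a + v = a' + v'] with [v] a vertex of [T(a)] and [v'] of [T(a')],
then both sides give minimal representations of the same point, so they agree
coordinatewise; hence the two pairs are equal, or [a = v'] and [a' = v]. As
[T(b_i)] can be chosen among the points of index at most [max(i, d)], the second
case only occurs for two of the first [d+1] points, so the [m(d+1)] sums [a + v]
have at most [d(d+1)/2] coincidences. *)

(** * Lexicographic sign of a vector *)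

Section LexicographicOrder.
Context {R : realFieldType} {n : nat}.
Implicit Types z u v : 'rV[R]_n.

Definition nonneg z := forall i, 0 <= z 0 i.

Definition supp z : {set 'I_n} := [set i | z 0 i != 0]%SET.

(** [lexneg (u - v)] says that [u] is strictly below [v], the highest index where they differ being
    decisive. *)
Definition lexneg z :=
  exists i : 'I_n, z 0 i < 0 /\ forall j : 'I_n, (i < j)%N -> z 0 j = 0.

Lemma lexneg0 : ~ lexneg 0.
Proof. by case=> i []; rewrite mxE ltxx. Qed.

Lemma lexnegD u v : lexneg u -> lexneg v -> lexneg (u + v).
Proof.
move=> [i [ui u0]] [j [vj v0]]; have [ij|ji|/val_inj ij] := ltngtP i j.
- exists j; split=> [|k jk]; rewrite !mxE; first by rewrite u0// add0r.
  by rewrite v0// u0 ?addr0// (ltn_trans ij).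
- exists i; split=> [|k ik]; rewrite !mxE; first by rewrite v0// addr0.
  by rewrite u0// v0 ?addr0// (ltn_trans ji).
- exists i; split=> [|k ik]; rewrite !mxE; first by rewrite ij in ui *; lra.
  by rewrite u0// v0 ?addr0// -ij.
Qed.

Lemma lexneg_scale (t : R) z : 0 < t -> lexneg z -> lexneg (t *: z).
Proof.
move=> t0 [i [zi z0]]; exists i; split=> [|j ij]; rewrite mxE.
  by rewrite pmulr_rlt0.
by rewrite z0// mulr0.
Qed.

Lemma lexneg_total z : z != 0 -> lexneg z \/ lexneg (- z).
Proof.
move=> /rV0Pn[i0 zi0].
have [i zi imax] := @arg_maxnP _ i0 (fun i => z 0 i != 0) val zi0.
have z0 (j : 'I_n) : (i < j)%N -> z 0 j = 0.
  by move=> ij; apply: contraTeq ij => /imax /=; rewrite leqNgt.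
have [zneg|zpos] : z 0 i < 0 \/ - z 0 i < 0.
  by apply/orP; rewrite oppr_lt0 -neq_lt.
- by left; exists i.
- by right; exists i; split=> [|j ij]; rewrite mxE// z0// oppr0.
Qed.

Lemma seq_lexmin (s : seq 'rV[R]_n) : s != [::] ->
  exists2 u, u \in s & forall v, v \in s -> ~ lexneg (v - u).
Proof.
elim: s => // x [_ _|y s IH _].
  exists x; rewrite ?mem_head// => v; rewrite inE => /eqP->.
  by rewrite subrr; exact: lexneg0.
have [//|u us umin] := IH.
have [xu|xu] := pselect (lexneg (x - u)).
  exists x; rewrite ?mem_head// => v; rewrite inE => /predU1P[->|vs].
    by rewrite subrr; exact: lexneg0.
  move=> vx; apply: (umin v vs); rewrite -(subrK x v) -addrA.
  exact: lexnegD.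
exists u; first by rewrite inE us orbT.
by move=> v; rewrite inE => /predU1P[->//|/umin].
Qed.

End LexicographicOrder.

(** * Lexicographically minimal nonnegative representations *)

Section LexicographicMinimum.
Context {R : realFieldType} {n D : nat} (M : 'M[R]_(n, D)).
Implicit Types (z lam mu nu : 'rV[R]_n) (T : {set 'I_n}).

Definition independent_rows T :=
  forall z, z *m M = 0 -> (forall i, z 0 i != 0 -> i \in T) -> z = 0.

(* Every nonnegative vector supported on [T] is the lexicographically smallest
   nonnegative vector with its image under [M]. *)
Definition good T := forall z,
  z *m M = 0 -> (forall i, z 0 i < 0 -> i \in T) -> ~ lexneg z.

Lemma good_independent T : good T -> independent_rows T.
Proof.
move=> gT z zM zT; have [//|/lexneg_total[]] := eqVneq z 0.
  by move=> /gT[]// i zi; rewrite zT// lt_eqF.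
move=> /gT[]; rewrite ?mulNmx ?zM ?oppr0// => i.
by rewrite mxE oppr_lt0 => zi; rewrite zT// gt_eqF.
Qed.

(** The ratio test of the simplex method: the largest step along [z] that preserves nonnegativity is
    the smallest ratio, and a coordinate attaining it vanishes. It is positive since [z] lowers only
    positive coordinates of [lam]. *)
Lemma ratio_test lam z (i0 : 'I_n) : nonneg lam -> z 0 i0 < 0 ->
    (forall i, z 0 i < 0 -> i \in supp lam) ->
  exists t, [/\ 0 < t, nonneg (lam + t *: z) &
    exists2 i, i \in supp lam & (lam + t *: z) 0 i = 0].
Proof.
move=> lam0 zi0 zsupp.
have [i zi imin] := @arg_minP _ _ _ i0 (fun i => z 0 i < 0)
    (fun i => lam 0 i / - z 0 i) zi0.
set t := lam 0 i / - z 0 i in imin.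
have lami : 0 < lam 0 i by have := zsupp i zi; rewrite inE lt_def lam0 andbT.
exists t; split.
- by rewrite divr_gt0// oppr_gt0.
- move=> j; rewrite !mxE; have [zj|zj] := ltP (z 0 j) 0.
    have := imin j zj; rewrite ler_pdivlMr ?oppr_gt0//.
    by rewrite mulrN; lra.
  by rewrite addr_ge0// mulr_ge0// divr_ge0 ?ltW// oppr_gt0.
- exists i; first exact: zsupp.
  by rewrite !mxE /t invrN mulrN mulNr mulfVK ?subrr// lt_eqF.
Qed.

(* Move along a lex-negative dependency until a coordinate vanishes. *)
Lemma independent_lexle lam : nonneg lam ->
  exists mu, [/\ nonneg mu, mu *m M = lam *m M, independent_rows (supp mu) &
    mu = lam \/ lexneg (mu - lam)].
Proof.
have [k] := ubnP #|supp lam|; elim: k lam => // k IH lam ltk lam0.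
have [?|] := pselect (independent_rows (supp lam)).
  by exists lam; split=> //; left.
move=> /existsNP[z0 /not_implyP[z0M /not_implyP[z0T /eqP z0N0]]].
have [z [zM zT zneg]] :
    exists z, [/\ z *m M = 0, forall i, z 0 i != 0 -> i \in supp lam & lexneg z].
  have [?|?] := lexneg_total _ z0N0; first by exists z0.
  exists (- z0); split=> //; first by rewrite mulNmx z0M oppr0.
  by move=> i; rewrite mxE oppr_eq0; exact: z0T.
have [i0 [zi0 _]] := zneg.
have [t [t0 nu0 [i lami nui]]] : exists t, [/\ 0 < t, nonneg (lam + t *: z) &
    exists2 i, i \in supp lam & (lam + t *: z) 0 i = 0].
  by apply: ratio_test zi0 _ => // i zi; rewrite zT// lt_eqF.
pose nu := lam + t *: z.
have nuM : nu *m M = lam *m M.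
  by rewrite mulmxDl -scalemxAl zM scaler0 addr0.
have nulam : lexneg (nu - lam) by rewrite addrAC subrr add0r; exact: lexneg_scale.
have nusupp : supp nu \proper supp lam.
  apply/properP; split.
    apply/fintype.subsetP => j; rewrite !inE !mxE.
    apply: contraNneq => lamj; have [->|/zT] := eqVneq (z 0 j) 0.
      by rewrite lamj mulr0 addr0.
    by rewrite inE lamj eqxx.
  by exists i; rewrite // inE negbK nui.
have [|//|mu [mu0 muM muI mule]] := IH nu.
  by rewrite -ltnS (leq_trans _ ltk)// ltnS proper_card.
exists mu; split=> //; first by rewrite muM.
right; case: mule => [->//|mule].
by rewrite -(subrK nu mu) -addrA; exact: lexnegD.
Qed.

(** By [independent_lexle], each representation has one with independent support weakly below it.
    Such a support determines its representation, so only finitely many candidates need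
    comparing. *)
Lemma exists_lexmin lam : nonneg lam ->
  exists mu, [/\ nonneg mu, mu *m M = lam *m M &
    forall nu, nonneg nu -> nu *m M = lam *m M -> ~ lexneg (nu - mu)].
Proof.
move=> lam0.
pose P T mu :=
  [/\ nonneg mu, mu *m M = lam *m M, independent_rows (supp mu) & supp mu = T].
have /choice[c cP] : forall T, exists mu, (exists nu, P T nu) -> P T mu.
  move=> T; have [[mu Pmu]|?] := pselect (exists nu, P T nu); first by exists mu.
  by exists 0.
pose s := [seq c T | T <- enum {set 'I_n} & `[< exists nu, P T nu >]].
have basic_s mu : nonneg mu -> mu *m M = lam *m M ->
    independent_rows (supp mu) -> mu \in s.
  move=> mu0 muM muI; have Pmu : exists nu, P (supp mu) nu by exists mu.
  have [c0 cM cI cS] := cP _ Pmu.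
  apply/mapP; exists (supp mu).
    by rewrite mem_filter mem_enum andbT; apply/asboolP.
  apply/eqP; rewrite -subr_eq0; apply/eqP/muI.
    by rewrite mulmxBl cM muM subrr.
  move=> i; apply: contraNT => iS; rewrite !mxE.
  have := iS; rewrite -{1}cS !inE !negbK => /eqP->.
  by move: iS; rewrite inE negbK => /eqP->; rewrite subrr.
have [mu1 [mu10 mu1M mu1I _]] := independent_lexle _ lam0.
have sN : s != [::] by apply: contraTneq (basic_s _ mu10 mu1M mu1I) => ->.
have [mu mus mumin] := seq_lexmin _ sN.
have [mu0 muM] : nonneg mu /\ mu *m M = lam *m M.
  have /mapP[T] := mus; rewrite mem_filter => /andP[/asboolP/cP[? ? _ _] _] ->.
  by [].
exists mu; split=> // nu nu0 nuM numu.
have [nu' [nu'0 nu'M nu'I nule]] := independent_lexle _ nu0.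
apply: (mumin nu'); first by apply: basic_s; rewrite ?nu'M.
case: nule => [->//|nule].
by rewrite -(subrK nu nu') -addrA; exact: lexnegD.
Qed.

(** At a lexicographic minimum, a lex-negative dependency with negative entries only in the support
    would allow a step to a smaller representation. If the minimum used an index beyond those of
    [lam], then [lam] itself would be smaller. *)
Lemma exists_good_supp lam : nonneg lam ->
  exists mu, [/\ nonneg mu, mu *m M = lam *m M, good (supp mu) &
    forall k : nat, (forall j : 'I_n, (k <= j)%N -> lam 0 j = 0) ->
      forall j : 'I_n, (k <= j)%N -> mu 0 j = 0].
Proof.
move=> lam0; have [mu [mu0 muM mumin]] := exists_lexmin _ lam0.
exists mu; split=> //.
- move=> z zM zsupp zneg; have [i0 [zi0 _]] := zneg.
  have [t [t0 nu0 _]] := ratio_test _ _ _ mu0 zi0 zsupp.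
  apply: (mumin (mu + t *: z)) => //.
  + by rewrite mulmxDl -scalemxAl zM scaler0 addr0 muM.
  + by rewrite addrAC subrr add0r; exact: lexneg_scale.
- move=> k lamk j kj; apply/eqP; apply/negPn/negP => muj.
  have [i mui imax] := @arg_maxnP _ j (fun i => mu 0 i != 0) val muj.
  have ki : (k <= i)%N by rewrite (leq_trans kj)//; exact: imax.
  apply: (mumin lam) => //; exists i; split=> [|l il]; rewrite !mxE.
    by rewrite lamk// sub0r oppr_lt0 lt_def mui mu0.
  rewrite lamk ?(leq_trans ki (ltnW il))// sub0r.
  by apply/eqP; rewrite oppr_eq0; apply: contraTT il => /imax /=; rewrite leqNgt.
Qed.

(** The difference of the two sides is a dependency with negative entries only in one of [T], [T'],
    and its opposite has them only in the other. Goodness keeps both from being lex-negative, so the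
    difference is zero. *)
Lemma good_sum_eq T T' lam lam' (v v' : 'I_n) :
    good T -> good T' -> supp lam \subset T -> supp lam' \subset T' ->
    nonneg lam -> nonneg lam' -> v \in T -> v' \in T' ->
    lam *m M + row v M = lam' *m M + row v' M ->
  lam + delta_mx 0 v = lam' + delta_mx 0 v'.
Proof.
have neg_supp (S : {set 'I_n}) (mu mu' : 'rV[R]_n) (w w' i : 'I_n) :
    supp mu \subset S -> nonneg mu' -> w \in S ->
    (mu' + delta_mx 0 w' - (mu + delta_mx 0 w)) 0 i < 0 -> i \in S.
  move=> muS mu'0 wS; apply: contraTT => iS; rewrite -leNgt !mxE eqxx/=.
  have /negPf-> : i != w by apply: contraNneq iS => ->.
  have -> : mu 0 i = 0.
    by apply/eqP; apply: contraNT iS => mui; rewrite (fintype.subsetP muS)// inE.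
  by rewrite !addr0 subr0 addr_ge0// ler0n.
move=> gT gT' lamT lam'T' lam0 lam'0 vT v'T' e.
have e0 : (lam' + delta_mx 0 v' - (lam + delta_mx 0 v)) *m M = 0.
  by rewrite mulmxBl !mulmxDl -!rowE e subrr.
apply/eqP; rewrite eq_sym -subr_eq0; apply/eqP.
have [//|/lexneg_total[]] := eqVneq (lam' + delta_mx 0 v' - (lam + delta_mx 0 v)) 0.
  by move=> /gT[]// i; exact: neg_supp.
rewrite opprB => /gT'[].
  by rewrite -opprB mulNmx e0 oppr0.
by move=> i; exact: neg_supp.
Qed.

End LexicographicMinimum.

(** * Signs of polynomials at small positive arguments *)

Section SmallParameter.
Context {R : realFieldType}.
Implicit Types p : {poly R}.

Lemma poly_bounded01 p :
  exists2 C, 0 < C & forall e, 0 < e <= 1 -> `|p.[e]| <= C.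
Proof.
elim/poly_ind: p => [|p c [C C0 pC]].
  by exists 1 => // e _; rewrite horner0 normr0.
exists (C + `|c|); first by rewrite ltr_pwDl.
move=> e /andP[e0 e1]; rewrite hornerMXaddC (le_trans (ler_normD _ _))// lerD2r.
rewrite normrM (gtr0_norm e0) (le_trans _ (pC e _)) ?e0//.
by rewrite ler_piMr.
Qed.

(** A nonzero constant term dominates near zero; otherwise a factor ['X] splits off, the value at
    zero is zero, and induction applies. *)
Lemma poly_sign_near0 p : p != 0 ->
  exists2 del, 0 < del & forall e, 0 < e < del ->
    p.[e] != 0 /\ (p.[0] < 0 -> p.[e] < 0).
Proof.
elim/poly_ind: p => [|p c IH]; first by rewrite eqxx.
have [->|c0 _] := eqVneq c 0.
  rewrite addr0 mulf_eq0 polyX_eq0 orbF => /IH[del del0 pdel].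
  exists del => // e edel; have [e0 _] := andP edel.
  rewrite !hornerMX mulr0 ltxx; split=> //.
  by apply: mulf_neq0; [have [] := pdel e edel | rewrite gt_eqF].
have [C C0 pC] := poly_bounded01 p.
exists (Num.min 1 (`|c| / C)); first by rewrite lt_min ltr01 divr_gt0 ?normr_gt0.
move=> e /andP[e0]; rewrite lt_min ltr_pdivlMr// => /andP[e1 ec].
rewrite !hornerMXaddC mulr0 add0r.
have small : `|p.[e] * e| < `|c|.
  rewrite normrM (gtr0_norm e0) (le_lt_trans _ ec)// mulrC ler_pM2l//.
  by rewrite pC// e0 ltW.
split.
  apply: contraTneq small => /eqP; rewrite addr_eq0 => /eqP->.
  by rewrite normrN ltxx.
move=> cneg; move: small; rewrite (ltr0_norm cneg) ltr_norml opprK.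
by lra.
Qed.

Lemma polys_sign_near0 (ps : seq {poly R}) :
  exists2 e, 0 < e & forall p, p \in ps -> p != 0 ->
    p.[e] != 0 /\ (p.[0] < 0 -> p.[e] < 0).
Proof.
suff [del del0 pdel] : exists2 del, 0 < del & forall p, p \in ps -> p != 0 ->
    forall e, 0 < e < del -> p.[e] != 0 /\ (p.[0] < 0 -> p.[e] < 0).
  exists (del / 2); first by rewrite divr_gt0.
  by move=> p pps p0; apply: (pdel p) => //; apply/andP; split; lra.
elim: ps => [|p ps [del del0 IH]]; first by exists 1.
have [->|/poly_sign_near0[del' del'0 pdel']] := eqVneq p 0.
  by exists del => // q; rewrite inE => /predU1P[->|/IH//]; rewrite eqxx.
exists (Num.min del del'); first by rewrite lt_min del0.
move=> q; rewrite inE => /predU1P[-> _|qps q0] e /andP[e0];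
  rewrite lt_min => /andP[edel edel'].
  by apply: pdel'; rewrite e0.
by apply: IH; rewrite ?e0.
Qed.

End SmallParameter.

(** * Generic perturbation and supports of full size *)

Section Perturbation.
Context {R : realFieldType} {n D : nat} (M : 'M[R]_(n, D)).
Implicit Types (lam mu : 'rV[R]_n) (T : {set 'I_n}).

(** Dual form of the condition that the first [D] rows of [M] span the whole space. *)
Context (spanM : forall g : 'cV[R]_D,
  (forall i : 'I_n, (i < D)%N -> (M *m g) i 0 = 0) -> g = 0).

(** Coefficients on the moment curve: distinct powers of [e] keep the rows from cancelling
    identically, and starting at exponent 1 makes the perturbation vanish at [e = 0]. *)
Definition moment (e : R) : 'rV[R]_n :=
  \row_i (if (i < D)%N then e ^+ i.+1 else 0).

(** For fixed [g] the perturbed value is a polynomial in [e] with coefficient [(M *m g) i 0] at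
    degree [i.+1] for [i < D]. By [spanM] these are not all zero when [g != 0]. *)
Lemma moment_perturbation lam (gs : seq 'cV[R]_D) :
  exists2 e, 0 < e & forall g, g \in gs -> g != 0 ->
    ((lam + moment e) *m M *m g) 0 0 != 0 /\
    ((lam *m M *m g) 0 0 < 0 -> ((lam + moment e) *m M *m g) 0 0 < 0).
Proof.
pose q (g : 'cV[R]_D) := \sum_(i < n) ((M *m g) i 0) *:
  ((lam 0 i)%:P + (if (i < D)%N then 'X^(i.+1) else 0)).
have qe g e : (q g).[e] = ((lam + moment e) *m M *m g) 0 0.
  rewrite -mulmxA mxE horner_sum; apply: eq_bigr => i _.
  rewrite hornerZ hornerD hornerC !mxE mulrC; case: ifP => _.
    by rewrite hornerXn.
  by rewrite horner0.
have q0 g : (q g).[0] = (lam *m M *m g) 0 0.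
  rewrite qe; congr ((_ *m M *m g) 0 0); apply/rowP => i; rewrite !mxE.
  by case: ifP; rewrite ?expr0n addr0.
have qN0 g : g != 0 -> q g != 0.
  apply: contra_neq => qg; apply: spanM => i iD.
  have := congr1 (fun p : {poly R} => p`_i.+1) qg.
  rewrite coef0 coef_sum (bigD1 i)//= big1 ?addr0.
    by rewrite coefZ coefD coefC iD coefXn eqxx add0r mulr1.
  move=> j ji; rewrite coefZ coefD coefC add0r.
  by case: ifP; rewrite ?coef0 ?mulr0// coefXn eqSS eq_sym val_eqE (negPf ji) mulr0.
have [e e0 qse] := polys_sign_near0 [seq q g | g <- gs].
exists e => // g ggs /qN0 qg.
by have := qse (q g) (map_f _ ggs) qg; rewrite qe q0.
Qed.

Definition selector T : 'M[R]_(#|T|, n) := rowsub (@enum_val _ (mem T)) 1%:M.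

Lemma mul_selector T (c : 'rV[R]_#|T|) i : i \notin T -> (c *m selector T) 0 i = 0.
Proof.
move=> iT; rewrite mxE big1// => k _; rewrite !mxE.
case: eqP => [e|]; last by rewrite mulr0.
by move: iT; rewrite -e enum_valP.
Qed.

Lemma selector_supp T mu : supp mu \subset T ->
  exists c : 'rV[R]_#|T|, mu = c *m selector T.
Proof.
move=> muT; exists (\row_k mu 0 (enum_val k)); apply/rowP => i.
have [iT|iT] := boolP (i \in T); last first.
  rewrite mul_selector//; apply/eqP; apply: contraNT iT => mui.
  by rewrite (fintype.subsetP muT)// inE.
rewrite mxE (bigD1 (enum_rank_in iT i))//= !mxE enum_rankK_in// eqxx mulr1.
rewrite big1 ?addr0// => k ki; rewrite !mxE; case: eqP => [e|]; last by rewrite mulr0.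
by case/eqP: ki; apply: enum_val_inj; rewrite enum_rankK_in.
Qed.

Lemma row_free_selector T : row_free (selector T).
Proof.
apply/row_freeP; exists (selector T)^T; apply/matrixP => i j.
rewrite mxE (bigD1 (enum_val i))//= !mxE eqxx mul1r big1 ?addr0.
  by rewrite eq_sym (inj_eq enum_val_inj).
by move=> k ki; rewrite !mxE eq_sym (negPf ki) mul0r.
Qed.

Lemma row_free_independent T : independent_rows M T -> row_free (selector T *m M).
Proof.
move=> indT; rewrite -kermx_eq0; apply/eqP/row_matrixP => k; rewrite row0.
have uM : row k (kermx (selector T *m M)) *m selector T *m M = 0.
  by rewrite -mulmxA -row_mul mulmx_ker row0.
have /(row_free_inj (row_free_selector T)) -> // :
  row k (kermx (selector T *m M)) *m selector T = 0 *m selector T.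
rewrite mul0mx; apply: indT => // i; apply: contraNT => iT.
by rewrite mul_selector.
Qed.

(* Perturbing towards the first [D] rows makes the lexicographic minimum
   nondegenerate, so its support has exactly [D] elements; a sufficiently small
   perturbation cannot leave the cone over a support not containing the point. *)
Lemma exists_good_basis lam : nonneg lam ->
  exists T mu, [/\ good M T, #|T| = D, nonneg mu /\ supp mu \subset T,
    mu *m M = lam *m M &
    forall k : nat, (D <= k)%N -> (forall j : 'I_n, (k <= j)%N -> lam 0 j = 0) ->
      forall j : 'I_n, j \in T -> (j < k)%N].
Proof.
move=> lam0.
pose L T : 'M[R]_(D, n) := pinvmx (selector T *m M) *m selector T.
(* Columns of [cokermx] are functionals vanishing on the rows in [T]; columns of [L T] read off
   coordinates when these rows form a basis. All [T] are listed because the support is known only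
   after [e] is fixed. *)
pose gs := [seq col j (cokermx (selector T *m M)) | T <- enum {set 'I_n}, j <- enum 'I_D]
  ++ [seq col j (L T) | T <- enum {set 'I_n}, j <- enum 'I_n].
have [e e0 gse] := moment_perturbation lam gs.
have lame0 : nonneg (lam + moment e).
  move=> i; rewrite !mxE addr_ge0//; case: ifP => // _.
  by rewrite exprn_ge0// ltW.
have [nu [nu0 nuM gT nutop]] := exists_good_supp M _ lame0.
set T := supp nu in gT.
have indT := good_independent _ _ gT.
have freeT := row_free_independent _ indT.
have [c nuc] := selector_supp T nu (subxx _).
(* If the rows in [T] did not span, a nonzero cokernel column would vanish at the perturbed point,
   against the choice of [e]. *)
have fullT : row_full (selector T *m M).
  rewrite -cokermx_eq0; apply/eqP.
  suff col_eq0 j : col j (cokermx (selector T *m M)) = 0.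
    by apply/matrixP => i j; move/matrixP/(_ i 0): (col_eq0 j); rewrite !mxE.
  apply/eqP; apply: contraT => gN0.
  have [|+ _] := gse _ _ gN0.
    by rewrite mem_cat; apply/orP; left; apply: allpairs_f; rewrite mem_enum.
  rewrite -nuM nuc colE (mulmxA _ (cokermx _)) -(mulmxA c) -(mulmxA c) mulmx_coker.
  by rewrite mulmx0 mul0mx mxE eqxx.
have LTM : L T *m M = 1%:M by rewrite -(mulmxA (pinvmx _)) mulVpmx.
exists T, (lam *m M *m L T); split=> //.
- by move: freeT fullT; rewrite /row_free /row_full => /eqP-> /eqP->.
- split; last first.
    apply/fintype.subsetP => i; apply: contraTT => iT.
    by rewrite inE mulmxA mul_selector ?eqxx.
  have LT : nu *m M *m L T = nu.
    apply/eqP; rewrite -subr_eq0; apply/eqP/indT.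
      by rewrite mulmxBl -(mulmxA _ (L T)) LTM mulmx1 subrr.
    move=> i; apply: contraNT => iT; rewrite /L !mulmxA.
    rewrite mxE mul_selector// add0r mxE oppr_eq0.
    by move: iT; rewrite inE negbK.
  move=> j.
  have entryE (x : 'rV[R]_D) : (x *m L T) 0 j = (x *m col j (L T)) 0 0.
    by rewrite colE mulmxA -colE [RHS]mxE.
  have [g0|gN0] := eqVneq (col j (L T)) 0.
    by rewrite entryE g0 mulmx0 mxE.
  (* A negative coordinate of the unperturbed point would stay negative after the perturbation,
     where it is an entry of [nu]. *)
  have [|_] := gse _ _ gN0.
    by rewrite mem_cat; apply/orP; right; apply: allpairs_f; rewrite mem_enum.
  rewrite -nuM -!entryE LT => h; rewrite leNgt; apply/negP => /h.
  by rewrite ltNge nu0.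
- by rewrite -(mulmxA _ (L T)) LTM mulmx1.
- move=> k Dk lamk j; apply: contraTT; rewrite -leqNgt inE negbK => kj.
  apply/eqP/(nutop k) => // i ki; rewrite !mxE lamk// add0r ifF//.
  by rewrite ltnNge (leq_trans Dk).
Qed.

End Perturbation.

(** * Affine geometry in homogeneous coordinates *)

Section Homogenization.
Context {R : realType} {d : nat}.
Implicit Types (x : 'rV[R]_d) (s : seq 'rV[R]_d).

(** The appended 1 turns affine independence into linear independence and records the sum of the
    coefficients of a combination. *)
Definition hom x : 'rV[R]_(d + 1) := row_mx x (const_mx 1).

Definition hom_mx s : 'M[R]_(size s, d + 1) := \matrix_(i < size s) hom s`_i.

Lemma hom_inj : injective hom.
Proof. by move=> x y /eq_row_mx[]. Qed.

Lemma row_hom_mx s (i : 'I_(size s)) : row i (hom_mx s) = hom s`_i.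
Proof. exact: rowK. Qed.

Lemma hom_mx_mulE s (g : 'cV[R]_(d + 1)) i :
  (hom_mx s *m g) i 0 = (hom s`_i *m g) 0 0.
Proof. by rewrite -row_hom_mx -row_mul [RHS]mxE. Qed.

Lemma hom_mx_sum s (mu : 'rV[R]_(size s)) x :
  mu *m hom_mx s = hom x -> \sum_i mu 0 i = 1.
Proof.
move/matrixP/(_ 0 (rshift d 0)); rewrite mxE row_mxEr mxE => <-.
by apply: eq_bigr => i _; rewrite mxE row_mxEr mxE mulr1.
Qed.

Lemma convex_hull_comb s x : convex_hull [set` s] x ->
  exists2 lam : 'rV[R]_(size s), nonneg lam & lam *m hom_mx s = hom x.
Proof.
pose C := [set y | exists2 lam : 'rV[R]_(size s),
  nonneg lam & lam *m hom_mx s = hom y].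
suff sub : (convex_hull [set` s] `<=` C)%classic by move=> /sub.
apply: smallest_sub.
  move=> y z t /set_mem[lam lam0 lamy] /set_mem[mu mu0 muz].
  have /andP[t0 t1] : 0 <= t%:num <= 1 by rewrite ge0 le1.
  apply/mem_set; exists (t%:num *: lam + (1 - t%:num) *: mu).
    by move=> i; rewrite !mxE addr_ge0// mulr_ge0// subr_ge0.
  rewrite mulmxDl -!scalemxAl lamy muz /hom !scale_row_mx add_row_mx.
  by congr row_mx; apply/matrixP => i j; rewrite !mxE !mulr1 subrKC.
move=> y /= ys; have ltys : (index y s < size s)%N by rewrite index_mem.
exists (delta_mx 0 (Ordinal ltys)).
  by move=> i; rewrite mxE ler0n.
by rewrite -rowE row_hom_mx/= nth_index.
Qed.

(** The column [g] encodes an affine function vanishing on [s]. A nonzero linear part would give a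
    hyperplane containing [s]; a zero one leaves a constant, which vanishes as [s] is nonempty. *)
Lemma proper_hom_mx s (g : 'cV[R]_(d + 1)) : (1 <= d)%N ->
  proper_dimensional [set` s] -> hom_mx s *m g = 0 -> g = 0.
Proof.
move=> d1 sP sg.
have eval y : y \in s ->
    \sum_(i < d) (usubmx g)^T 0 i * y 0 i = - (dsubmx g) 0 0.
  move=> ys; have ltys : (index y s < size s)%N by rewrite index_mem.
  have := hom_mx_mulE s g (Ordinal ltys).
  rewrite sg mxE/= nth_index// /hom -[in RHS](vsubmxK g) mul_row_col.
  rewrite 2!mxE [X in _ + X]mxE big_ord1 [const_mx 1 _ _]mxE mul1r.
  move/esym/eqP; rewrite addr_eq0 => /eqP <-.
  by apply: eq_bigr => i _; rewrite mxE mulrC.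
have [u0|uN0] := eqVneq (usubmx g)^T 0; last first.
  case: (sP [set x | \sum_(i < d) (usubmx g)^T 0 i * x 0 i = - (dsubmx g) 0 0]).
    by exists (usubmx g)^T, (- (dsubmx g) 0 0).
  by move=> y /= ys; exact: eval.
have [y ys] : exists y, y \in s.
  case: (s) sP => [sP|y s' _]; last by exists y; rewrite mem_head.
  (* The empty set lies in every hyperplane, and [1 <= d] provides one. *)
  exfalso; apply: (sP [set x | \sum_(i < d) (const_mx 1 : 'rV[R]_d) 0 i * x 0 i = 0]).
    exists (const_mx 1), 0; split=> //; apply/rV0Pn.
    by exists (Ordinal d1); rewrite mxE oner_neq0.
  by move=> y.
have := eval y ys; rewrite u0 big1; last by move=> i _; rewrite mxE mul0r.
move/esym/eqP; rewrite oppr_eq0 => /eqP c0.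
rewrite -[g]vsubmxK -[usubmx g]trmxK u0 trmx0.
have -> : dsubmx g = 0 by apply/matrixP => i j; rewrite !ord1 c0 mxE.
by rewrite col_mx0.
Qed.

(** By [proper_hom_mx] the homogenized points have rank [d + 1]; that many independent ones are
    moved to the front. *)
Lemma exists_spanning_order s : (1 <= d)%N -> uniq s ->
    proper_dimensional [set` s] ->
  exists s' : seq 'rV[R]_d, [/\ uniq s', s' =i s &
    forall g : 'cV[R]_(d + 1),
      (forall i : 'I_(size s'), (i < d + 1)%N -> (hom_mx s' *m g) i 0 = 0) ->
    g = 0].
Proof.
move=> d1 us sP.
have full : row_full (hom_mx s).
  rewrite -cokermx_eq0; apply/eqP/matrixP => i j.
  have /matrixP/(_ i 0) : col j (cokermx (hom_mx s)) = 0.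
    apply: (proper_hom_mx s) => //.
    by rewrite colE (mulmxA _ (cokermx _)) mulmx_coker mul0mx.
  by rewrite !mxE.
pose f := fullrankfun full.
pose s0 := [seq s`_(f i) | i <- enum 'I_(d + 1)].
have sz0 : size s0 = (d + 1)%N by rewrite size_map size_enum_ord.
have s0s : {subset s0 <= s} by move=> y /mapP[i _ ->]; rewrite mem_nth.
exists (s0 ++ [seq x <- s | x \notin s0]); split.
- rewrite cat_uniq filter_uniq// andbT map_inj_uniq; last first.
    move=> i j /eqP; rewrite nth_uniq// => /eqP/val_inj.
    exact: fullrankfun_inj.
  rewrite enum_uniq/= -all_predC; apply/allP => y.
  by rewrite mem_filter => /andP[].
- move=> y; rewrite mem_cat mem_filter; have [/s0s->//|] := boolP (y \in s0).
  by [].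
move=> g g0.
apply: (row_full_inj (A := rowsub f (hom_mx s))).
  exact: fullrowsub_full.
rewrite mulmx0; apply/matrixP => i j; rewrite ord1 [RHS]mxE.
have lti : (i < size (s0 ++ [seq x <- s | x \notin s0]))%N.
  by rewrite size_cat sz0 (leq_trans (ltn_ord i))// leq_addr.
have := g0 (Ordinal lti) (ltn_ord i); rewrite hom_mx_mulE/= nth_cat sz0 ltn_ord.
rewrite (nth_map i) ?size_enum_ord// nth_ord_enum => <-.
by rewrite -hom_mx_mulE mul_rowsub_mx mxE.
Qed.

End Homogenization.

(** * Vertex sums and their coincidences *)

Section Counting.
Context {R : realType} {d : nat} (s : seq 'rV[R]_d).
Implicit Types (x : 'rV[R]_d) (T : {set 'I_(size s)}).

Context (s_uniq : uniq s).
Context (span_s : forall g : 'cV[R]_(d + 1),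
  (forall i : 'I_(size s), (i < d + 1)%N -> (hom_mx s *m g) i 0 = 0) -> g = 0).

(** [T] indexes the vertices of a simplex containing [x]. The last clause is what confines
    collisions to the first [d + 1] points. *)
Definition local_basis x T := [/\ good (hom_mx s) T, #|T| = (d + 1)%N,
  exists mu, [/\ nonneg mu, supp mu \subset T & mu *m hom_mx s = hom x] &
  forall i j : 'I_(size s), x = s`_i -> j \in T -> (j < d + 1)%N || (j <= i)%N].

Lemma exists_local_basis x : convex_hull [set` s] x -> exists T, local_basis x T.
Proof.
move=> /convex_hull_comb[lam lam0 lamx].
have [[i xi]|xs] := pselect (exists i : 'I_(size s), x = s`_i).
  have del0 : nonneg (delta_mx 0 i : 'rV[R]_(size s)).
    by move=> j; rewrite mxE ler0n.
  have [T [mu [gT cT [mu0 muT] muM top]]] := exists_good_basis _ span_s _ del0.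
  exists T; split=> //.
    by exists mu; split=> //; rewrite muM -rowE row_hom_mx xi.
  move=> i' j /eqP; rewrite xi nth_uniq// => /eqP/val_inj <- jT.
  (* The bound must be at least [d + 1] for [exists_good_basis] and exceed [i] for the unit vector
     at [i] to vanish from there on. *)
  have := top (maxn (d + 1) i.+1) (leq_maxl _ _) _ j jT.
  rewrite leq_max ltnS; apply => l; rewrite geq_max => /andP[_ il].
  by rewrite mxE eqxx; case: eqP il => // ->; rewrite ltnn.
have [T [mu [gT cT [mu0 muT] muM top]]] := exists_good_basis _ span_s _ lam0.
exists T; split=> //; first by exists mu; split=> //; rewrite muM.
by move=> i j xi; case: xs; exists i.
Qed.

Lemma unit_coordinate (mu : 'rV[R]_(size s)) i :
  nonneg mu -> \sum_j mu 0 j = 1 -> 1 <= mu 0 i -> mu = delta_mx 0 i.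
Proof.
move=> mu0; rewrite (bigD1 i)//= => sum1 mui.
have rest0 : 0 <= \sum_(j | j != i) mu 0 j by apply: sumr_ge0.
have restE : \sum_(j | j != i) mu 0 j = 0 by lra.
apply/rowP => j; rewrite mxE eqxx/=; have [->|ji] := eqVneq j i.
  by move: sum1; rewrite restE addr0.
apply/eqP; move/eqP: restE; rewrite psumr_eq0// => /allP/(_ j).
by rewrite mem_index_enum ji => /(_ isT).
Qed.

(** For [v != v'], the equality from [good_sum_eq] makes coordinate [v'] of [mu] at least 1. The
    coordinates sum to 1, so [mu] is a unit vector, and then so is [mu']. *)
Lemma local_basis_collision x x' T T' (v v' : 'I_(size s)) :
    local_basis x T -> local_basis x' T' -> v \in T -> v' \in T' ->
    x + s`_v = x' + s`_v' -> (x, v) != (x', v') ->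
  [/\ v != v', (v < d + 1)%N && (v' < d + 1)%N, x = s`_v' & x' = s`_v].
Proof.
move=> [gT _ [mu [mu0 muT mux]] top] [gT' _ [mu' [mu'0 mu'T' mux']] top'] vT v'T' e.
have mu_eq : mu + delta_mx 0 v = mu' + delta_mx 0 v'.
  apply: good_sum_eq gT gT' _ _ _ _ vT v'T' _ => //.
  by rewrite mux mux' !row_hom_mx /hom !add_row_mx e.
have [vv'|vv'] := eqVneq v v'.
  by move: e; rewrite vv' => /addIr->; rewrite eqxx.
move=> _.
have muE : mu = delta_mx 0 v'.
  apply: unit_coordinate => //; first exact: hom_mx_sum mux.
  have := congr1 (fun z : 'rV[R]_(size s) => z 0 v') mu_eq.
  by rewrite !mxE !eqxx/= eq_sym (negPf vv') addr0 => ->; rewrite lerDr.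
have mu'E : mu' = delta_mx 0 v.
  by move: mu_eq; rewrite muE addrC => /addIr.
have xE : x = s`_v' by apply: hom_inj; rewrite -mux muE -rowE row_hom_mx.
have x'E : x' = s`_v by apply: hom_inj; rewrite -mux' mu'E -rowE row_hom_mx.
split=> //.
(* If [v] exceeded [d], then [v <= v'], so [v'] would exceed [d] too and [v' <= v], forcing
   equality; likewise with the roles exchanged. *)
have := top _ _ xE vT; have := top' _ _ x'E v'T'.
move: vv'; rewrite -val_eqE/=; lia.
Qed.

Lemma card_sumset_ge (A B : {fset 'rV[R]_d}) : s =i B ->
    [set` A] `<=` convex_hull [set` s] ->
  (#|` A|%fset * (d + 1) <= #|` sumset A B|%fset + 'C(d + 1, 2))%N.
Proof.
move=> sB AS.
have /choice[T TP] : forall x, exists T, x \in A -> local_basis x T.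
  move=> x; have [xA|] := boolP (x \in A); last by exists finset.set0.
  by have [T ?] := exists_local_basis _ (AS x xA); exists T.
pose ps := [seq (x, v) | x <- enum_fset A, v <- enum (T x)].
have psP x v : (x, v) \in ps -> (x \in A) /\ (v \in T x).
  by move=> /allpairsPdep[x' [v' [x'A + [-> ->]]]]; rewrite mem_enum.
have ps_uniq : uniq ps.
  apply: allpairs_uniq_dep; first exact: fset_uniq.
    by move=> x _; exact: enum_uniq.
  by move=> [x v] [x' v'] _ _ /= [-> ->].
have ps_size : size ps = (#|` A|%fset * (d + 1))%N.
  rewrite size_allpairs_dep sumnE big_map big_seq.
  rewrite (eq_bigr (fun=> (d + 1)%N)); last first.
    by move=> x xA; rewrite -cardE; have [] := TP x xA.
  by rewrite -big_seq big_const_seq count_predT iter_addn_0 mulnC.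
(* A collision pairs the point at [v'] and vertex [v] with the point at [v] and vertex [v']. The one
   whose vertex has the smaller index is listed here, so discarding these pairs breaks every
   collision. *)
pose bad := [seq (s`_i, j) | i <- iota 0 (d + 1), j <- iota 0 i].
have bad_size : size bad = 'C(d + 1, 2).
  rewrite size_allpairs_dep -bin2_sum sumnE big_map.
  by rewrite /index_iota subn0; apply: eq_bigr => i _; rewrite size_iota.
pose isbad (p : 'rV[R]_d * 'I_(size s)) := (p.1, val p.2) \in bad.
have few_bad : (count isbad ps <= size bad)%N.
  rewrite -size_filter -(size_map (fun p => (p.1, val p.2))).
  apply: uniq_leq_size; last by move=> q /mapP[p]; rewrite mem_filter => /andP[? _] ->.
  rewrite map_inj_uniq ?filter_uniq//.
  by move=> [x v] [x' v'] /= [-> /val_inj->].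
have good_pairs : (count (predC isbad) ps <= #|` sumset A B|%fset)%N.
  rewrite -size_filter -(size_map (fun p : 'rV[R]_d * 'I_(size s) => p.1 + s`_p.2)).
  apply: uniq_leq_size; last first.
    move=> y /mapP[[x v]]; rewrite mem_filter => /andP[_ /psP[xA vT]] -> /=.
    by apply/imfset2P; exists x => //; exists s`_v; rewrite //= -sB mem_nth.
  rewrite map_inj_in_uniq ?filter_uniq// => -[x v] [x' v'].
  rewrite !mem_filter => /andP[/= nb /psP[xA vT]] /andP[/= nb' /psP[x'A v'T']] e.
  apply/eqP; apply: contraT => ne.
  have [vv' /andP[vd v'd] xE x'E] :=
    local_basis_collision _ _ _ _ _ _ (TP x xA) (TP x' x'A) vT v'T' e ne.
  have [lt|lt|/val_inj eqv] := ltngtP v v'.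
  - case/negP: nb; rewrite /isbad/= xE; apply/allpairsPdep.
    by exists (val v'), (val v); rewrite !mem_iota.
  - case/negP: nb'; rewrite /isbad/= x'E; apply/allpairsPdep.
    by exists (val v), (val v'); rewrite !mem_iota.
  - by rewrite eqv eqxx in vv'.
by rewrite -ps_size -(count_predC isbad) addnC -bad_size leq_add.
Qed.

End Counting.

Theorem theorem1p4 (R : realType) (d : nat) (d_ge1 : (1 <= d)%N)
    (A B : {fset 'rV[R]_d}) (m : nat) (card_A : #|` A|%fset = m)
    (B_proper : proper_dimensional [set` B])
    (A_sub_conv : [set` A] `<=` convex_hull [set` B]) :
  m%:R * (d%:R + 1) - d%:R * (d%:R + 1) / 2 <= (#|` sumset A B|%fset)%:R :> R.
Proof.
have [s [us sB span]] := exists_spanning_order _ d_ge1 (fset_uniq B) B_proper.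
have AS : [set` A] `<=` convex_hull [set` s].
  by rewrite (_ : [set` s] = [set` B])//; apply/seteqP; split=> x /=; rewrite sB.
have := card_sumset_ge s us span A B sB AS; rewrite card_A.
(* The additive bound over the naturals is cast to [R] before subtracting and halving. *)
rewrite -(ler_nat R) natrD natrM natrD.
have : ('C(d + 1, 2)%:R * 2 : R) = (d%:R + 1) * d%:R.
  rewrite -natrM (bin_ffact _ 2) addn1 ffactnS ffactn1/= natrM.
  by rewrite -natr1.
by lra.
Qed.
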